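(* Let $\alpha=\log(1/h)$ and let $c>0$ with $\alpha c<1$. Let $(\delta_n)$ be a sequence of real numbers with $\lim_{n\to\infty}\delta_n(\log n)^{\alpha c}=0$, and define the random set $\mathcal A_n=\{u\in\mathbb Z:\ \xi(u,n)\ge(1-\delta_n)\lambda_0\log n\}$. Then $$\lim_{n\to\infty}\max_{u\in\mathcal A_n}\max_{|z|\le c\log\log n}\left|\frac{\xi(u+z,n)}{m_z\lambda_0\log n}-1\right|=0\quad\text{a.s.}$$
   Context: Let $0<q<p<1$ with $p+q=1$, $h=q/p$, $\lambda_0=-1/\log(2q)$. Let $X_1,X_2,\dots$ be i.i.d. with $\mathbf P(X_1=1)=p$, $\mathbf P(X_1=-1)=q$, $S_0=0$, $S_n=X_1+\dots+X_n$. For $z\in\mathbb Z$, $n\ge1$, let $\xi(z,n)=\#\{k:0<k\le n,\ S_k=z\}$. For $z\in\mathbb Z$ put $m_z=h^{|z|}/(2q)$ if $z\ne0$ and $m_0=1$. The maximum over $z$ runs over integers $z$. *)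

(* Defs.v *)
From HB Require Import structures.
From mathcomp Require Import all_boot all_order all_algebra.
From mathcomp Require Import all_classical all_reals all_analysis.
Set Implicit Arguments. Unset Strict Implicit. Unset Printing Implicit Defensive.
Import Order.TTheory GRing.Theory Num.Theory.
Import numFieldNormedType.Exports.
Local Open Scope classical_set_scope.
Local Open Scope ring_scope.

Section Defs.
Context {d : measure_display} {T : measurableType d} {R : realType}.

Definition mutually_independent (P : probability T R) (X : nat -> T -> R) : Prop :=
  (forall k, measurable_fun setT (X k)) /\
  forall (J : seq nat) (B : nat -> set R), uniq J ->
    (forall j, measurable (B j)) ->
    P (\bigcap_(j in [set` J]) (X j @^-1` B j)) =
      (\prod_(j <- J) P (X j @^-1` B j))%E.

(* Walk: X 0, X 1, ... play the role of X_1, X_2, ...;  S n = X_1 + ... + X_n. *)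
Definition walk (X : nat -> T -> R) (n : nat) (w : T) : R :=
  \sum_(k < n) X k w.

Definition xi (X : nat -> T -> R) (z : int) (n : nat) (w : T) : nat :=
  #|[set k : 'I_n.+1 | (0 < (k : nat))%N && (walk X k w == z%:~R)]|.

End Defs.

Definition hratio {R : realType} (p q : R) : R := q / p.
Definition lambda0 {R : realType} (q : R) : R := - 1 / ln (2 * q).
Definition mz {R : realType} (p q : R) (z : int) : R :=
  if z == 0 then 1 else (hratio p q) ^+ `|z|%N / (2 * q).

(* Main.v *)
Require Import Defs.
From HB Require Import structures.
From mathcomp Require Import all_boot all_order all_algebra.
From mathcomp Require Import all_classical all_reals all_analysis.
From mathcomp Require Import ring lra zify.
Import Order.TTheory GRing.Theory Num.Theory.
Import numFieldNormedType.Exports.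
Set Implicit Arguments. Unset Strict Implicit. Unset Printing Implicit Defensive.
Local Open Scope classical_set_scope.
Local Open Scope ring_scope.

(* Fix u and z <> 0, and reward every visit to u by a factor alpha and every
   visit to u + z by a factor beta = 1 + t or 1 - t with t small.  For
   alpha = (1 + y) / (2 q + y), y = theta h^|z|, the product of the rewards times
   a suitable combination of the Green functions of u and u + z is a nonnegative
   supermartingale; to first order ln alpha = - ln (2 q) - m_z ln beta.
   With M = ln N and gamma = 1 - c ln (1 / h), the maximal inequality bounds by
   M exp (- M - eps M^gamma), up to constants, the probability that before time N
   the point u gets lambda_0 (M - eps M^gamma) visits while the number of visits
   to u + z differs from m_z lambda_0 M by a factor 1 + e or 1 - e; this uses
   h^|z| M >= M^gamma.  The union bound over |u| <= N and |z| = O(M) costs a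
   factor M exp M, so along N = 2^j the bounds are summable and Borel-Cantelli
   applies; times between two powers of 2 shift ln n only by a constant. *)

(** * Deterministic paths and their local times *)

(* A path is encoded by its steps, the most recent one first. *)
Fixpoint endpoint (s : seq bool) : int :=
  if s is b :: s' then endpoint s' + (if b then 1 else -1) else 0.

Fixpoint visits (y : int) (s : seq bool) : nat :=
  if s is b :: s' then (visits y s' + (endpoint s == y))%N else 0%N.

Lemma endpoint_le_size s : (`|endpoint s| <= size s)%N.
Proof. by elim: s => //= b s IH; case: b; lia. Qed.

(** This confines the union bound to finitely many sites: a site with a positive number of visits
    lies within the time horizon. *)
Lemma visits_far y s : (size s < `|y|)%N -> visits y s = 0%N.
Proof.
elim: s => // b s IH H.
have /negPf e : endpoint (b :: s) != y.
  by apply: contraTneq H => <-; rewrite -leqNgt endpoint_le_size.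
by rewrite -[LHS]/(visits y s + (endpoint (b :: s) == y))%N e IH//; move: H => /=; lia.
Qed.

(** * The path of the random walk and its passage times *)

Section StepsOf.
Context {d : measure_display} {T : measurableType d} {R : realType}.
Variable X : nat -> T -> R.

(** Any value other than 1 is read as a downward step, so the law of the encoded path follows from
    the probability of the value 1 alone. *)
Fixpoint steps (n : nat) (w : T) : seq bool :=
  if n is m.+1 then (X m w == 1) :: steps m w else [::].

Lemma size_steps n w : size (steps n w) = n.
Proof. by elim: n => //= n ->. Qed.

Lemma walk_endpoint w n : (forall k, X k w = 1 \/ X k w = -1) ->
  walk X n w = (endpoint (steps n w))%:~R.
Proof.
move=> H; elim: n => [|n IH]; first by rewrite /walk big_ord0.
rewrite /walk big_ord_recr/= -/(walk X n w) IH intrD.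
case: (H n) => ->; first by rewrite eqxx.
by rewrite (_ : (-1 == 1) = false)//; apply/eqP; lra.
Qed.

Lemma xi_visits w n y : (forall k, X k w = 1 \/ X k w = -1) ->
  xi X y n w = visits y (steps n w).
Proof.
move=> H.
have xiE m : xi X y m w = (\sum_(k < m.+1) ((0 < k)%N && (walk X k w == y%:~R)))%N.
  rewrite /xi -sum1_card big_mkcond /=; apply: eq_bigr => k _.
  by case: ifPn => [|/negP]; rewrite inE/=; [move=> ->|move=> /negP/negPf ->].
elim: n => [|n IH]; first by rewrite xiE big_ord_recr big_ord0.
rewrite xiE big_ord_recr /= -xiE IH; congr (_ + nat_of_bool _)%N.
by rewrite (walk_endpoint _ H) eqr_int.
Qed.

Lemma visits_mono w y i j : (i <= j)%N ->
  (visits y (steps i w) <= visits y (steps j w))%N.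
Proof. by move=> ij; rewrite -(subnK ij); elim: (j - i)%N => //= k IH; lia. Qed.

(** At the least time with [K] visits the count has just risen, so the walk stands at [y]; time 0 is
    excluded by [0 < K]. Knowing the position is what later bounds the potential from below. *)
Lemma first_passage w y n (K : R) : 0 < K -> K <= (visits y (steps n w))%:R ->
  exists i, [/\ (i <= n)%N, endpoint (steps i w) = y,
    K <= (visits y (steps i w))%:R & (forall j, (j < i)%N -> (visits y (steps j w))%:R < K)].
Proof.
move=> K0 Hn.
have ex : exists i, K <= (visits y (steps i w))%:R by exists n.
case: (ex_minnP ex) => -[|i] Hi min; first by move: Hi; rewrite leNgt K0.
exists i.+1; split => //; first exact: min.
  apply/eqP; apply: contraT => /negPf E.
  by move: Hi; rewrite /= E addn0 => /min; rewrite ltnn.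
by move=> j ji; rewrite ltNge; apply/negP => /min; rewrite leqNgt ji.
Qed.

(** Take the later of the two first passage times: the other count has already reached its level and
    cannot decrease. *)
Lemma joint_passage w y y' n (K K' : R) : 0 < K -> 0 < K' ->
  K <= (visits y (steps n w))%:R -> K' <= (visits y' (steps n w))%:R ->
  exists2 i, (i <= n)%N &
    [/\ endpoint (steps i w) = y \/ endpoint (steps i w) = y',
      K <= (visits y (steps i w))%:R & K' <= (visits y' (steps i w))%:R].
Proof.
move=> K0 K'0 /(first_passage K0)[i [ni ei hi _]] /(first_passage K'0)[j [nj ej hj _]].
case: (leqP i j) => ij.
  exists j => //; split; [by right| |exact: hj].
  by apply: le_trans hi _; rewrite ler_nat visits_mono.
exists i => //; split; [by left|exact: hi|].
by apply: le_trans hj _; rewrite ler_nat visits_mono// ltnW.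
Qed.

End StepsOf.

(** * Path probabilities and the maximal inequality *)

Section Maximal.
Context {d : measure_display} {T : measurableType d} {R : realType}.
Variables (P : probability T R) (X : nat -> T -> R) (p q : R).
Hypothesis pq1 : p + q = 1.
Hypothesis indX : mutually_independent P X.
Hypothesis PX1 : forall k, P (X k @^-1` [set 1]) = p%:E.

Let mX k : measurable_fun setT (X k). Proof. exact: (indX.1 k). Qed.

Let stepset (b : bool) : set R := if b then [set 1] else ~` [set 1].

Let m_stepset b : measurable (stepset b).
Proof. by case: b => /=; [|apply: measurableC]; exact: measurable_set1. Qed.

Let m_step k b : measurable (X k @^-1` stepset b).
Proof. by rewrite -[X in measurable X]setTI; apply: mX => //; exact: m_stepset. Qed.

Let prob_step b : R := if b then p else q.

Let P_step k b : P (X k @^-1` stepset b) = (prob_step b)%:E.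
Proof.
case: b; first exact: PX1.
rewrite (_ : _ @^-1` _ = ~` (X k @^-1` [set 1]))// probability_setC; last exact: (m_step k true).
by rewrite PX1 -EFinB /prob_step -pq1 addrAC subrr add0r.
Qed.

Lemma measurable_steps n (B : pred (seq bool)) : measurable [set w | B (steps X n w)].
Proof.
elim: n B => [|n IH] B.
  by case: (boolP (B [::])) => HB;
    [rewrite (_ : [set _ | _] = setT)|rewrite (_ : [set _ | _] = set0)] => //;
    apply/seteqP; split => w //=; rewrite (negPf HB).
rewrite (_ : [set _ | _] =
    (X n @^-1` stepset true `&` [set w | B (true :: steps X n w)]) `|`
    (X n @^-1` stepset false `&` [set w | B (false :: steps X n w)])).
  by apply: measurableU; apply: measurableI; first [exact: m_step | apply: (IH (fun s => B (_ :: s)))].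
apply/seteqP; split => w /=.
  by case: eqP => h; [left|right].
by move=> [[-> ?]|[/eqP/negPf -> ?]] //; rewrite eqxx.
Qed.

Definition cylinder (s : seq bool) : set T := [set w | steps X (size s) w = s].

Lemma measurable_cylinder s : measurable (cylinder s).
Proof.
rewrite (_ : cylinder s = [set w | pred1 s (steps X (size s) w)]).
  exact: measurable_steps.
by apply/seteqP; split => w /= /eqP.
Qed.

Lemma P_cylinder s : P (cylinder s) = (\prod_(b <- s) prob_step b)%:E.
Proof.
(* The list [s] has its latest step first, so the event of step [j] is read off the reversed
   list. *)
pose B s j := stepset (nth false (rev s) j).
have in_iota n j : [set` iota 0 n] j <-> (j < n)%N by rewrite /= mem_iota.
have cylE : cylinder s = \bigcap_(j in [set` iota 0 (size s)]) (X j @^-1` B s j).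
  elim: s => [|b s IH]; first by apply/seteqP; split => w.
  have Bcons j : (j < size s)%N -> B (b :: s) j = B s j.
    by move=> js; rewrite /B rev_cons nth_rcons size_rev js.
  have Blast : B (b :: s) (size s) = stepset b.
    by rewrite /B rev_cons nth_rcons size_rev ltnn eqxx.
  apply/seteqP; split => w.
    move=> [hb hs] j /in_iota; rewrite [size _]/= ltnS leq_eqVlt => /orP[/eqP ->|js].
      rewrite /= Blast -hb.
      by case: eqP.
    have : (cylinder s) w by [].
    by rewrite IH => /(_ j); rewrite /= Bcons//; apply; apply/in_iota.
  move=> H; rewrite /cylinder /=; congr cons.
    have := H (size s); rewrite /= Blast => /(_ ((in_iota _ _).2 (ltnSn _))).
    by case: b {H Bcons Blast} => /= [->|/eqP/negPf ->//]; rewrite eqxx.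
  suff : (cylinder s) w by [].
  rewrite IH => j /in_iota js; rewrite /= -Bcons//.
  by apply: H; apply/in_iota; rewrite /= ltnS ltnW.
rewrite cylE indX.2 ?iota_uniq//; last by move=> j; exact: m_stepset.
rewrite (eq_bigr (fun j => (prob_step (nth false (rev s) j))%:E)); last first.
  by move=> j _; exact: P_step.
rewrite prodEFin; congr EFin.
rewrite [RHS](perm_big (rev s)) /=; last by rewrite perm_sym perm_rev.
rewrite [RHS](big_nth false) size_rev.
by rewrite /index_iota subn0.
Qed.

Lemma P_cylinder_cons b s :
  P (cylinder (b :: s)) = ((if b then p else q)%:E * P (cylinder s))%E.
Proof. by rewrite !P_cylinder big_cons EFinM. Qed.

Lemma measurable_hit m N (B : pred (seq bool)) :
  measurable [set w | exists i, (m <= i <= N)%N /\ B (steps X i w)].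
Proof.
rewrite (_ : [set _ | _] =
    \bigcup_(i in [set i | (m <= i <= N)%N]) [set w | B (steps X i w)]).
  by apply: bigcup_measurable => i _; exact: measurable_steps.
by apply/seteqP; split => w /= [i]; [case=> mi Bi; exists i|move=> mi Bi; exists i].
Qed.

(* Doob's maximal inequality for the nonnegative supermartingale [V (steps X n w)]. *)
Lemma maximal_ineq (V : seq bool -> R) (B : pred (seq bool)) (l : R) (N : nat) :
  0 <= p -> 0 <= q -> 0 < l ->
  (forall s, 0 <= V s) ->
  (forall s, p * V (true :: s) + q * V (false :: s) <= V s) ->
  (forall s, B s -> l <= V s) ->
  (P [set w | exists i, (i <= N)%N /\ B (steps X i w)] <= (V [::] / l)%:E)%E.
Proof.
move=> p0 q0 l0 V0 superV BV.
pose hit m := [set w | exists i, (m <= i <= N)%N /\ B (steps X i w)].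
have mhit m : measurable (hit m) by exact: measurable_hit.
have mc s : measurable (cylinder s) by exact: measurable_cylinder.
(* Backward induction on the remaining time [k], given the initial path [s]. If [s] is in [B], then
   [V s / l] is at least 1; otherwise a hit must come after one more step, and the supermartingale
   property combines the two continuations. *)
suff main k s : (size s + k = N.+1)%N ->
    (P (cylinder s `&` hit (size s)) <= (V s / l)%:E * P (cylinder s))%E.
  have := main N.+1 [::] erefl.
  rewrite /cylinder [size _]/= (_ : [set w | _] = setT) ?setTI ?probability_setT ?mule1//.
  by apply/seteqP; split.
elim: k s => [|k IH] s.
  rewrite addn0 => ->; rewrite (_ : _ `&` _ = set0) ?measure0; last first.
    by apply/seteqP; split => w //= -[_ [i [/andP[Ni iN] _]]]; lia.
  by apply: mule_ge0 => //; rewrite lee_fin divr_ge0// ltW.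
move=> sk; have [Bs|NBs] := boolP (B s).
  apply: (@le_trans _ _ (P (cylinder s))).
    by apply: le_measure; rewrite ?inE//; exact: measurableI.
  rewrite -[leLHS]mul1e; apply: lee_wpmul2r => //.
  by rewrite lee_fin ler_pdivlMr// mul1r BV.
have splitE : cylinder s `&` hit (size s) =
    (cylinder (true :: s) `&` hit (size s).+1) `|` (cylinder (false :: s) `&` hit (size s).+1).
  apply/seteqP; split => w.
    move=> [/= cs [i [/andP[si iN] Bi]]].
    have si' : (size s < i)%N.
      by rewrite ltn_neqAle si andbT; apply: contraNneq NBs => E; rewrite -cs E.
    case E : (X (size s) w == 1); [left|right]; split; rewrite /cylinder /= ?E ?cs//;
      by exists i; rewrite si' iN.
  by case=> -[[_ cs] [i [/andP[si iN] Bi]]]; split => //; exists i; rewrite (ltnW si) iN.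
rewrite splitE measureU; first last.
- by apply/seteqP; split => w //; rewrite /cylinder => -[[] /= [-> _] _ [[]]].
- by apply: measurableI.
- by apply: measurableI.
have hb b : (P (cylinder (b :: s) `&` hit (size s).+1) <=
    (V (b :: s) / l)%:E * ((if b then p else q)%:E * P (cylinder s)))%E.
  by rewrite -P_cylinder_cons; apply: (IH (b :: s)); rewrite /= addSnnS.
apply: (le_trans (leeD (hb true) (hb false))).
rewrite P_cylinder -!EFinM -EFinD lee_fin.
set c := \prod_(_ <- _) _.
have c0 : 0 <= c by apply: prodr_ge0 => -[].
rewrite (_ : _ + _ = (p * V (true :: s) + q * V (false :: s)) / l * c); last by ring.
by rewrite ler_wpM2r// ler_wpM2r ?invr_ge0 ?superV// ltW.
Qed.

End Maximal.

(** * Green functions and the supermartingale of the rewarded walk *)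

Section Potential.
Context {R : realType}.
Variables (p q : R).
Hypotheses (q0 : 0 < q) (qp : q < p) (pq1 : p + q = 1).
Let h := hratio p q.

(* [(1 - 2 * q)^-1 * green x] is the expected number of visits to [0] at
   positive times of the walk started at [x]. *)
Definition green (x : int) : R :=
  if x == 0 then 2 * q else if x < 0 then 1 else h ^+ `|x|%N.

Let p0 : 0 < p. Proof. exact: lt_trans qp. Qed.
Let h0 : 0 < h. Proof. by rewrite /h /hratio divr_gt0. Qed.
Let hp : h * p = q. Proof. by rewrite /h /hratio divfK// gt_eqF. Qed.
Let h1 : h < 1. Proof. by rewrite /h /hratio ltr_pdivrMr// mul1r. Qed.
Let h2q : h <= 2 * q. Proof. by rewrite /h /hratio ler_pdivrMr//; move: q0 qp pq1 => *; nra. Qed.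

Lemma green_gt0 x : 0 < green x.
Proof. by rewrite /green; case: ifP => _; [rewrite mulr_gt0|case: ifP => // _; rewrite exprn_gt0]. Qed.

Lemma green_le1 x : green x <= 1.
Proof.
rewrite /green; case: ifP => _; [move: qp pq1 => *; lra|case: ifP => // _].
by rewrite exprn_ile1 // ltW.
Qed.

Lemma green_nat n : green (Posz n.+1) = h ^+ n.+1.
Proof. by []. Qed.

Lemma green_neg n : green (Negz n) = 1.
Proof. by []. Qed.

Lemma green0 : green 0 = 2 * q. Proof. by []. Qed.

(** First-step decomposition of the expected number of visits: a step landing on 0 counts as a visit
    itself, worth [1 - 2 * q] in this normalisation. *)
Lemma green_step x : p * green (x + 1) + q * green (x - 1) + (1 - 2 * q) *
    (p * (x + 1 == 0)%:R + q * (x - 1 == 0)%:R) = green x.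
Proof.
have alg (h' g : R) : h' * p = q -> p * (h' * (h' * g)) + q * g = h' * g.
  by move=> e; rewrite -[RHS]mulr1 -pq1 -e; ring.
have hq n : p * h ^+ n.+2 + q * h ^+ n = h ^+ n.+1 by rewrite !exprS alg.
case: x => [[|[|n]]|[|n]].
- rewrite (_ : 0%:Z + 1 = 1%:Z)// (_ : 0%:Z - 1 = Negz 0)// green0 green_nat green_neg.
  rewrite (_ : (1%:Z == 0) = false)// (_ : (Negz 0 == 0) = false)//.
  by rewrite mulr0n !mulr0 !addr0 mulr0 addr0 mulr1 expr1 [p * h]mulrC hp; ring.
- rewrite (_ : 1%:Z + 1 = 2%:Z)// (_ : 1%:Z - 1 = 0%:Z)// green0 !green_nat eqxx.
  rewrite (_ : (2%:Z == 0) = false)// mulr0n mulr1n mulr0 add0r mulr1.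
  rewrite expr2 mulrA [p * h]mulrC hp expr1 -[RHS]mulr1 -[X in _ = _ * X]pq1 mulrDr hp.
  ring.
- rewrite (_ : n.+2%:Z + 1 = n.+3%:Z); last by lia.
  rewrite (_ : n.+2%:Z - 1 = n.+1%:Z); last by lia.
  rewrite (_ : (n.+3%:Z == 0) = false)// (_ : (n.+1%:Z == 0) = false)//.
  by rewrite !green_nat mulr0n !mulr0 addr0 mulr0 addr0 hq.
- rewrite (_ : Negz 0 + 1 = 0%:Z)// (_ : Negz 0 - 1 = Negz 1)// green0 !green_neg eqxx.
  rewrite (_ : (Negz 1 == 0) = false)// mulr0n mulr1n mulr0 addr0 !mulr1.
  by rewrite -[RHS]pq1; ring.
- rewrite (_ : Negz n.+1 + 1 = Negz n); last by lia.
  rewrite (_ : Negz n.+1 - 1 = Negz n.+2); last by lia.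
  rewrite (_ : (Negz n == 0) = false)// (_ : (Negz n.+2 == 0) = false)//.
  by rewrite !green_neg mulr0n !mulr0 addr0 mulr0 addr0 !mulr1.
Qed.

(** Of the two passages between 0 and [z], one follows the drift and is certain, the other has
    probability h^|z|. *)
Lemma green_mul_opp z : z != 0 -> green z * green (- z) = h ^+ `|z|%N.
Proof.
case: z => [[|n]|n] // _; first by rewrite green_nat (_ : - _ = Negz n)// green_neg mulr1.
by rewrite green_neg mul1r (_ : - _ = Posz n.+1)// green_nat.
Qed.

Lemma green_ge z : z != 0 -> h ^+ `|z|%N <= green z.
Proof.
by move=> z0; rewrite -green_mul_opp// ler_piMr ?green_le1// ltW// green_gt0.
Qed.

Lemma hpow_le z : z != 0 -> h ^+ `|z|%N <= 2 * q.
Proof.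
move=> z0; apply: le_trans h2q.
by rewrite -[leRHS]expr1 ler_wiXn2l ?(ltW h0) ?(ltW h1)// absz_gt0.
Qed.

(** [green x] is also the probability of visiting 0 at a positive time from [x], and passing through
    [z] first is only one way of doing so. The proof checks the cases of the explicit formula. *)
Lemma green_submul x z : z != 0 -> green z * green (x - z) <= green x.
Proof.
move=> z0.
have [->|x0] := eqVneq x 0; first by rewrite sub0r green_mul_opp// green0 hpow_le.
have [->|xz] := eqVneq x z.
  by rewrite ler_piMr ?green_le1// ltW// green_gt0.
case: (ltP x 0) => xneg.
  rewrite [leRHS](_ : _ = 1); last by rewrite /green (negPf x0) xneg.
  by rewrite mulr_ile1 ?green_le1// ltW// green_gt0.
rewrite [green x]/green (negPf x0) ltNge xneg /= /green (negPf z0) subr_eq0 (negPf xz).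
case: (ltP z 0) => zneg; case: (ltP (x - z) 0) => xzneg.
- by move: zneg xzneg xneg; lia.
- by rewrite mul1r ler_wiXn2l ?(ltW h0) ?(ltW h1)//; lia.
- by rewrite mulr1 ler_wiXn2l ?(ltW h0) ?(ltW h1)//; lia.
- by rewrite -exprD ler_wiXn2l ?(ltW h0) ?(ltW h1)//; lia.
Qed.

(* [theta] is the coefficient of the second Green function and [alpha] the critical
   weight of a visit to [0] once a visit to [z] has weight [beta]. *)
Definition theta (beta : R) := (beta - 1) / (1 - 2 * q * beta).
Definition alpha (beta : R) (z : int) : R :=
  (1 + theta beta * h ^+ `|z|%N) / (2 * q + theta beta * h ^+ `|z|%N).

(** For the rewarded process to be a martingale, the reward at 0 must add [1 - 2 * q] to this
    function and the reward at [z] must add (1 - 2q) theta [green z]; these two equations determine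
    [alpha] and [theta]. The factor [green z] makes the value at 0 depend on [z] only through
    h^|z|. *)
Definition potential (beta : R) (z x : int) : R := green x + theta beta * green z * green (x - z).

Definition weight (beta : R) (u z : int) (s : seq bool) : R :=
  alpha beta z ^+ visits u s * beta ^+ visits (u + z) s * potential beta z (endpoint s - u).

Section Weight.
Variables (beta : R) (z : int).
Hypotheses (z0 : z != 0) (be0 : 0 < beta) (be1 : 2 * q * beta < 1) (th1 : -1 < theta beta).

Let H := h ^+ `|z|%N.
Let H0 : 0 < H. Proof. by rewrite exprn_gt0. Qed.
Let H2q : H <= 2 * q. Proof. exact: hpow_le. Qed.

Let thH_gt : - (2 * q) < theta beta * H.
Proof. by move: th1 H0 H2q => *; nra. Qed.

Lemma al_gt1 : 1 < alpha beta z.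
Proof. by rewrite /alpha -/H; move: thH_gt q0 qp pq1 => *; rewrite ltr_pdivlMr; lra. Qed.

(** For negative [theta], above -1, the subtracted term stays below [green x] by [green_submul]. *)
Lemma pot_ge0 x : 0 <= potential beta z x.
Proof.
rewrite /potential; have := green_submul x z0; have := green_gt0 z; have := green_gt0 (x - z).
move=> a b; have : 0 < green z * green (x - z) by exact: mulr_gt0.
by move: th1; rewrite -mulrA; move: (green z * _) => g *; nra.
Qed.

Lemma pot_le x : potential beta z x <= 1 + `|theta beta|.
Proof.
apply: lerD; first exact: green_le1.
apply: (le_trans (ler_norm _)); rewrite -mulrA normrM ler_piMr//.
rewrite ger0_norm; last by rewrite mulr_ge0// ltW// green_gt0.
by rewrite mulr_ile1 ?green_le1// ltW// green_gt0.
Qed.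

Lemma pot0 : potential beta z 0 = 2 * q + theta beta * H.
Proof. by rewrite /potential sub0r -mulrA green_mul_opp. Qed.

Lemma potz : potential beta z z = green z * (1 + 2 * q * theta beta).
Proof. by rewrite /potential subrr green0; ring. Qed.

Let wpos (x : int) : R := alpha beta z ^+ (x == 0) * beta ^+ (x == z) * potential beta z x.

Lemma wposE x : wpos x =
  potential beta z x + (1 - 2 * q) * (x == 0)%:R + (1 - 2 * q) * theta beta * green z * (x == z)%:R.
Proof.
have Q : 2 * q + theta beta * H != 0 by move: thH_gt => *; rewrite gt_eqF//; lra.
rewrite /wpos; have [->|x0] := eqVneq x 0.
  rewrite eq_sym (negPf z0) /= expr1 expr0 mulr1 pot0 /alpha -/H divfK//; ring.
have [->|xz] := eqVneq x z; last by rewrite /=; ring.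
rewrite expr0 expr1 mul1r potz mulr0n mulr1n /theta.
by field; rewrite gt_eqF// subr_gt0.
Qed.

(** Equality holds: by [wposE] the rewards at the next position add exactly the point masses that
    [green_step] requires for the two Green functions. *)
Lemma weight_super u s : p * weight beta u z (true :: s) + q * weight beta u z (false :: s)
  <= weight beta u z s.
Proof.
have wE b : weight beta u z (b :: s) = alpha beta z ^+ visits u s * beta ^+ visits (u + z) s *
    wpos (endpoint s - u + (if b then 1 else -1)).
  rewrite /weight /wpos /= !exprD [endpoint s - u + _]addrAC.
  move: (endpoint s + _) => y.
  rewrite subr_eq0 subr_eq [z + u]addrC.
  by rewrite -!mulrA; congr (_ * _); rewrite mulrCA.
rewrite !wE /weight; set c := alpha beta z ^+ _ * beta ^+ _; set x := endpoint s - u.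
have c0 : 0 <= c by apply: mulr_ge0; apply: exprn_ge0; [exact: ltW (lt_trans ltr01 al_gt1)|exact: ltW].
rewrite mulrCA [q * _]mulrCA -mulrDr ler_wpM2l// !wposE /potential.
have := green_step x; have := green_step (x - z).
rewrite (_ : x - z + 1 = x + 1 - z); last by ring.
rewrite (_ : x - z - 1 = x - 1 - z); last by ring.
rewrite !subr_eq0 -/(green z) => <- <-.
by rewrite le_eqVlt; apply/orP; left; apply/eqP; ring.
Qed.

Lemma weight_ge0 u s : 0 <= weight beta u z s.
Proof.
apply: mulr_ge0; last exact: pot_ge0.
by apply: mulr_ge0; apply: exprn_ge0; [exact: ltW (lt_trans ltr01 al_gt1)|exact: ltW].
Qed.

End Weight.
End Potential.

(** * Numerical estimates for the choice of the rewards *)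

Section Numeric.
Context {R : realType}.
Implicit Types q y t e m lam M G : R.

Lemma ln_le_sub1 (x : R) : 0 < x -> ln x <= x - 1.
Proof. by move=> x0; rewrite -{1}(subrKC 1 x) le_ln1Dx//; lra. Qed.

Lemma ln_ge_1sub (x : R) : 0 < x -> 1 - x^-1 <= ln x.
Proof.
move=> x0; have := @ln_le_sub1 x^-1; rewrite invr_gt0 lnV ?posrE// => /(_ x0); lra.
Qed.

(** The right-hand side is convex in [y], and the left-hand side is its tangent at [y = 0]. *)
Lemma ln_ratio_ge q y : 0 < q -> 2 * q < 1 -> - (2 * q) < y ->
  - ln (2 * q) - y * (1 - 2 * q) / (2 * q) <= ln ((1 + y) / (2 * q + y)).
Proof.
move=> q0 q1 y0.
have a0 : 0 < 1 + y by lra.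
have b0 : 0 < 2 * q + y by lra.
have c0 : 0 < 2 * q by lra.
rewrite ln_div ?posrE//.
(* This ratio equals 1 at [y = 0], so the inequality is sharp to first order; what remains is a
   nonnegative quadratic term. *)
have := @ln_le_sub1 ((2 * q + y) / (2 * q * (1 + y))).
rewrite divr_gt0 ?mulr_gt0// => /(_ isT).
rewrite ln_div ?posrE ?mulr_gt0// lnM ?posrE// => H.
have -> : y * (1 - 2 * q) / (2 * q) =
   (2 * q + y) / (2 * q * (1 + y)) - 1 + y ^+ 2 * (1 - 2 * q) / (2 * q * (1 + y)).
  by field; rewrite !gt_eqF.
have : 0 <= y ^+ 2 * (1 - 2 * q) / (2 * q * (1 + y)).
  by apply: divr_ge0; apply: mulr_ge0; rewrite ?sqr_ge0//; lra.
by lra.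
Qed.

(* The visits to [z] cost [m * t] per visit to [0] in [ln alpha] and bring back
   [(1 + e) * m * t]; the gain, of order [e * m * t], beats the quadratic errors. *)
Lemma tilt_upper q e m lam M G t eps y :
  0 < q -> 2 * q < 1 -> 0 < e -> e <= 1 -> lam * - ln (2 * q) = 1 -> 0 < lam ->
  0 <= G -> G <= M -> 0 <= m -> m <= 1 -> G <= m * M ->
  t = e * (1 - 2 * q) / 16 -> eps = lam * t * e / 4 ->
  y = t / (1 - 2 * q * (1 + t)) * (2 * q * m) ->
  M + eps * G <= ln ((1 + y) / (2 * q + y)) * (lam * (M - eps * G)) +
    ln (1 + t) * ((1 + e) * m * lam * M).
Proof.
move=> q0 q1 e0 e1 laml lam0 G0 GM m0 m1 GmM tE epsE yE.
have [D DE] : exists D, D = 1 - 2 * q by exists (1 - 2 * q).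
rewrite -DE in tE; have D0 : 0 < D by lra.
have t0 : 0 < t by rewrite tE divr_gt0// mulr_gt0.
have tD : t <= D / 16 by rewrite tE; nra.
have te : t <= e / 16 by rewrite tE; nra.
have Dt0 : 0 < D - 2 * q * t by nra.
have DtE : 1 - 2 * q * (1 + t) = D - 2 * q * t by rewrite DE; ring.
(* The tangent bound makes the loss in [ln alpha] equal to [m * t * A]; the size of [t] keeps [A]
   close to 1. *)
have [A AE] : exists A, A = D / (D - 2 * q * t) by exists (D / (D - 2 * q * t)).
have A1 : A <= 1 + e / 4.
  have v0 : 0 <= 2 * q * t by rewrite !mulr_ge0// ltW.
  have v1 : 2 * q * t <= t by nra.
  have v2 : e * (2 * q * t) <= 2 * q * t by nra.
  by rewrite AE ler_pdivrMr//; lra.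
have y0 : 0 <= y by rewrite yE DtE !mulr_ge0 ?invr_ge0; lra.
have eps0 : 0 <= eps by rewrite epsE divr_ge0// !mulr_ge0// ltW.
have lamD : lam * D <= 1.
  by have := @ln_le_sub1 (2 * q); rewrite mulr_gt0// => /(_ isT) ?; nra.
have eps1 : eps <= 1.
  have lde : lam * D * e <= 1 * e by rewrite ler_wpM2r// ltW.
  have lt1 : lam * t <= 1 by rewrite tE; lra.
  have : lam * t * e <= 1 * e by rewrite ler_wpM2r// ltW.
  by rewrite epsE; lra.
have h1 : - ln (2 * q) - m * t * A <= ln ((1 + y) / (2 * q + y)).
  apply: le_trans (ln_ratio_ge q0 q1 _); last by lra.
  rewrite lerD2l lerN2 le_eqVlt; apply/orP; left; apply/eqP.
  rewrite yE DtE AE -DE; field; rewrite gt_eqF//=; lra.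
have h2 : t * (1 - e / 16) <= ln (1 + t).
  apply: le_trans (@ln_ge_1sub _ _); last by lra.
  rewrite (_ : 1 - (1 + t)^-1 = t / (1 + t)); last by field; lra.
  by rewrite ler_wpM2l ?(ltW t0)// -[leRHS]mul1r ler_pdivlMr; nra.
have epsG : eps * G <= G by nra.
have epsG0 : 0 <= eps * G by rewrite mulr_ge0.
have h3 : (- ln (2 * q) - m * t * A) * (lam * (M - eps * G)) <=
    ln ((1 + y) / (2 * q + y)) * (lam * (M - eps * G)).
  by rewrite ler_wpM2r// mulr_ge0//; lra.
have h4 : t * (1 - e / 16) * ((1 + e) * m * lam * M) <= ln (1 + t) * ((1 + e) * m * lam * M).
  by rewrite ler_wpM2r// !mulr_ge0//; lra.
apply: le_trans (lerD h3 h4).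
have mlt : 0 <= m * lam * t by rewrite !mulr_ge0// ltW.
have A0 : 0 <= A by rewrite AE divr_ge0// ltW.
have h5 : lam * t * G <= m * lam * t * M.
  by rewrite (_ : m * lam * t * M = lam * t * (m * M)); [rewrite ler_wpM2l ?mulr_ge0// ltW|ring].
rewrite (_ : (- ln (2 * q) - m * t * A) * (lam * (M - eps * G)) =
  (lam * - ln (2 * q)) * (M - eps * G) - m * lam * t * (A * (M - eps * G))); last by ring.
rewrite laml mul1r.
rewrite (_ : t * (1 - e / 16) * ((1 + e) * m * lam * M) =
  m * lam * t * (((1 - e / 16) * (1 + e)) * M)); last by ring.
have h6 : m * lam * t * (A * (M - eps * G)) <= m * lam * t * ((1 + e / 4) * M).
  apply: ler_wpM2l => //; apply: ler_pM => //; lra.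
have h7 : m * lam * t * ((1 + e / 4 + e / 2) * M) <= m * lam * t * ((1 - e / 16) * (1 + e) * M).
  by apply: ler_wpM2l => //; apply: ler_wpM2r; nra.
(* The term [eps * G] has to be paid twice, for the target and for the lowered level. By the choice
   of [eps] this is [e / 2 * (lam * t * G)], covered by the surplus in [h7] because [G <= m * M]. *)
have h8 : e / 2 * (lam * t * G) <= e / 2 * (m * lam * t * M) by apply: ler_wpM2l => //; lra.
have e8 : eps * G = e / 4 * (lam * t * G) by rewrite epsE; ring.
rewrite e8; move: h6 h7 h8; rewrite e8; lra.
Qed.

(** Now visits to [z] are penalised and [ln alpha] rises by about [m * t]. With only
    [(1 - e) * m * lam * M] visits the penalty falls short of the total rise by a margin of relative
    order [e], which again pays for the quadratic errors and the lowered level. *)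
Lemma tilt_lower q e m lam M G t eps y :
  0 < q -> 2 * q < 1 -> 0 < e -> e <= 1 -> lam * - ln (2 * q) = 1 -> 0 < lam ->
  0 <= G -> G <= M -> 0 <= m -> m <= 1 -> G <= m * M ->
  t = e * (1 - 2 * q) / 16 -> eps = lam * t * e / 4 ->
  y = - t / (1 - 2 * q * (1 - t)) * (2 * q * m) ->
  M + eps * G <= ln ((1 + y) / (2 * q + y)) * (lam * (M - eps * G)) +
    ln (1 - t) * ((1 - e) * m * lam * M).
Proof.
move=> q0 q1 e0 e1 laml lam0 G0 GM m0 m1 GmM tE epsE yE.
have [D DE] : exists D, D = 1 - 2 * q by exists (1 - 2 * q).
rewrite -DE in tE; have D0 : 0 < D by lra.
have t0 : 0 < t by rewrite tE divr_gt0// mulr_gt0.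
have tD : t <= D / 16 by rewrite tE; nra.
have te : t <= e / 16 by rewrite tE; nra.
have Dt0 : 0 < D + 2 * q * t by nra.
have DtE : 1 - 2 * q * (1 - t) = D + 2 * q * t by rewrite DE; ring.
have [A AE] : exists A, A = D / (D + 2 * q * t) by exists (D / (D + 2 * q * t)).
have A1 : 1 - e / 16 <= A.
  have v0 : 0 <= 2 * q * t by rewrite !mulr_ge0// ltW.
  have v1 : 2 * q * t <= t by nra.
  have v2 : 0 <= e * (2 * q * t) by rewrite mulr_ge0// ltW.
  have v3 : e * (2 * q * t) <= 2 * q * t by nra.
  by rewrite AE ler_pdivlMr//; lra.
have y0 : - (2 * q) < y.
  have : t / (D + 2 * q * t) < 1 by rewrite ltr_pdivrMr//; nra.
  rewrite yE DtE mulNr; have : 0 < t / (D + 2 * q * t) by rewrite divr_gt0.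
  move: (t / _) => r r0 r1.
  have m2 : q * m <= q by nra.
  have : r * (q * m) <= r * q by rewrite ler_wpM2l// ltW.
  have : r * q < q by nra.
  lra.
have eps0 : 0 <= eps by rewrite epsE divr_ge0// !mulr_ge0// ltW.
have lamD : lam * D <= 1.
  by have := @ln_le_sub1 (2 * q); rewrite mulr_gt0// => /(_ isT) ?; nra.
have eps1 : eps <= e / 4.
  have lde : lam * D * e <= 1 * e by rewrite ler_wpM2r// ltW.
  have lt1 : lam * t <= 1 by rewrite tE; lra.
  have : lam * t * e <= 1 * e by rewrite ler_wpM2r// ltW.
  by rewrite epsE; lra.
have h1 : - ln (2 * q) + m * t * A <= ln ((1 + y) / (2 * q + y)).
  apply: le_trans (ln_ratio_ge q0 q1 y0).
  rewrite lerD2l le_eqVlt; apply/orP; left; apply/eqP.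
  rewrite yE DtE AE -DE; field; rewrite gt_eqF//=; lra.
have h2 : - t * (1 + e / 8) <= ln (1 - t).
  apply: le_trans (@ln_ge_1sub _ _); last by lra.
  rewrite (_ : 1 - _ = - t / (1 - t)); last by field; lra.
  by rewrite !mulNr lerN2 ler_wpM2l ?(ltW t0)// -[leLHS]mul1r ler_pdivrMr; nra.
(* The rise of [ln alpha] is multiplied by [M - eps * G], so here this factor must not be too
   small. *)
have MG : (1 - e / 4) * M <= M - eps * G by nra.
have M0 : 0 <= M by lra.
have h3 : (- ln (2 * q) + m * t * A) * (lam * (M - eps * G)) <=
    ln ((1 + y) / (2 * q + y)) * (lam * (M - eps * G)).
  by rewrite ler_wpM2r// mulr_ge0//; nra.
have h4 : - t * (1 + e / 8) * ((1 - e) * m * lam * M) <= ln (1 - t) * ((1 - e) * m * lam * M).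
  by rewrite ler_wpM2r// !mulr_ge0//; lra.
apply: le_trans (lerD h3 h4).
have mlt : 0 <= m * lam * t by rewrite !mulr_ge0// ltW.
have h5 : lam * t * G <= m * lam * t * M.
  by rewrite (_ : m * lam * t * M = lam * t * (m * M)); [rewrite ler_wpM2l ?mulr_ge0// ltW|ring].
rewrite (_ : (- ln (2 * q) + m * t * A) * (lam * (M - eps * G)) =
  (lam * - ln (2 * q)) * (M - eps * G) + m * lam * t * (A * (M - eps * G))); last by ring.
rewrite laml mul1r.
rewrite (_ : - t * (1 + e / 8) * ((1 - e) * m * lam * M) =
  - (m * lam * t * ((1 + e / 8) * (1 - e) * M))); last by ring.
have h6 : m * lam * t * ((1 - e / 16) * ((1 - e / 4) * M)) <= m * lam * t * (A * (M - eps * G)).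
  apply: ler_wpM2l => //; apply: ler_pM => //; [lra|].
  by apply: mulr_ge0 => //; lra.
have h7 : m * lam * t * (((1 + e / 8) * (1 - e) + e / 2) * M) <=
    m * lam * t * ((1 - e / 16) * ((1 - e / 4) * M)).
  by apply: ler_wpM2l => //; rewrite mulrA; apply: ler_wpM2r => //; nra.
have h8 : e / 2 * (lam * t * G) <= e / 2 * (m * lam * t * M) by apply: ler_wpM2l => //; lra.
have e8 : eps * G = e / 4 * (lam * t * G) by rewrite epsE; ring.
rewrite e8; move: h6 h7 h8; rewrite e8; lra.
Qed.

End Numeric.

(** * Probability of a deviation for fixed sites *)

Section Deviation.
Context {d : measure_display} {T : measurableType d} {R : realType}.
Variables (P : probability T R) (X : nat -> T -> R) (p q : R).
Hypotheses (q0 : 0 < q) (qp : q < p) (pq1 : p + q = 1).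
Hypothesis indX : mutually_independent P X.
Hypothesis PX1 : forall k, P (X k @^-1` [set 1]) = p%:E.

Let h := hratio p q.
Let h0 : 0 < h. Proof. by rewrite /h /hratio divr_gt0// (lt_trans q0). Qed.

Definition hits (N : nat) (B : pred (seq bool)) : set T :=
  [set w | exists i, (i <= N)%N /\ B (steps X i w)].

Lemma measurable_hits N B : measurable (hits N B).
Proof. exact: (measurable_hit indX 0 N B). Qed.

Lemma hits_false N B : (forall s, ~~ B s) -> P (hits N B) = 0%E.
Proof.
move=> nB; rewrite (_ : hits N B = set0) ?measure0//.
by apply/seteqP; split => w //= -[i [_]]; apply/negP.
Qed.

Lemma P_hits_bigcup (I : eqType) (L : seq I) (B : I -> pred (seq bool)) N (b : R) :
  (forall i, i \in L -> (P (hits N (B i)) <= b%:E)%E) ->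
  measurable (\bigcup_(i in [set` L]) hits N (B i)) /\
  (P (\bigcup_(i in [set` L]) hits N (B i)) <= ((size L)%:R * b)%:E)%E.
Proof.
elim: L => [|i L IH] Hb.
  rewrite (_ : \bigcup_(_ in _) _ = set0) ?measure0 ?mul0r//.
  by apply/seteqP; split => w // -[].
have [mL PL] := IH (fun j jL => Hb j (@mem_behead _ (i :: L) j jL)).
have -> : \bigcup_(i in [set` i :: L]) hits N (B i) =
    hits N (B i) `|` ((\bigcup_(i in [set` L]) hits N (B i)) `\` hits N (B i)).
  apply/seteqP; split => w.
    move=> [j /=]; rewrite in_cons => /orP[/eqP ->|jL] Hj; first by left.
    by have [?|?] := pselect (hits N (B i) w); [left|right; split => //; exists j].
  move=> [?|[[j /= jL ?] _]]; [exists i|exists j] => //=; rewrite in_cons ?eqxx//.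
  by rewrite jL orbT.
have mi := measurable_hits N (B i).
split; first by apply: measurableU => //; apply: measurableD.
rewrite measureU//; [|exact: measurableD|by rewrite setDIK].
rewrite [size _]/= mulrS mulrDl mul1r EFinD.
apply: leeD; first by apply: Hb; rewrite mem_head.
apply: le_trans PL; apply: le_measure; rewrite ?inE//; exact: measurableD.
Qed.

(** Maximal inequality for [weight]. On [B] the rewards multiply to at least exp E, and the
    potential is at least h^|z| / 2 because the path ends at [u] or [u + z]. The initial value is at
    most 1 + |theta| <= 2, whence the constant 4. *)
Lemma P_hits_tilted (beta : R) (u z : int) N (B : pred (seq bool)) (E : R) :
  z != 0 -> 0 < beta -> 2 * q * beta < 1 -> `|theta q beta| <= 1 / 2 ->
  (forall s, B s -> (endpoint s = u \/ endpoint s = u + z) /\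
    E <= ln (alpha p q beta z) * (visits u s)%:R + ln beta * (visits (u + z) s)%:R) ->
  (P (hits N B) <= (4 / h ^+ `|z|%N * expR (- E))%:E)%E.
Proof.
move=> z0 be0 be1; rewrite ler_norml => /andP[th0 th1] HB.
have th1' : -1 < theta q beta by lra.
have p0 : 0 < p by exact: lt_trans qp.
set H := h ^+ `|z|%N; have H0 : 0 < H by rewrite exprn_gt0.
have H2q : H <= 2 * q by exact: (hpow_le q0 qp pq1).
have al1 : 1 < alpha p q beta z by exact: al_gt1.
have l0 : 0 < H / 2 * expR E by rewrite mulr_gt0 ?expR_gt0 ?divr_gt0.
have potge s : endpoint s = u \/ endpoint s = u + z ->
    H / 2 <= potential p q beta z (endpoint s - u).
  move=> [->|->].
    rewrite subrr pot0// -/h -/H.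
    have : - (1 / 2) * H <= theta q beta * H by rewrite ler_wpM2r// ltW.
    lra.
  rewrite addrAC subrr add0r potz.
  have g : H <= green p q z by exact: green_ge.
  have a : 2 * q < 1 by move: qp pq1 => *; lra.
  have b : 1 / 2 <= 1 + 2 * q * theta q beta by move: q0 => *; nra.
  by apply: ler_pM => //; [exact: ltW|lra].
have BV s : B s -> H / 2 * expR E <= weight p q beta u z s.
  move=> /HB[/potge es HE]; rewrite /weight [leRHS]mulrC.
  apply: ler_pM => //; rewrite ?expR_ge0 ?divr_ge0 ?(ltW H0)//.
  rewrite -ler_expR expRD !expRM_natr !lnK ?posrE// in HE.
  exact: lt_trans ltr01 al1.
have := maximal_ineq pq1 indX PX1 N (ltW p0) (ltW q0) l0
  (weight_ge0 q0 qp pq1 z0 be0 th1' u) (weight_super q0 qp pq1 z0 be0 be1 th1' u) BV.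
move=> /le_trans; apply; rewrite lee_fin ler_pdivrMr//.
rewrite (_ : 4 / H * expR (- E) * (H / 2 * expR E) = 2 * (expR E * expR (- E))); last first.
  by field; rewrite gt_eqF.
rewrite expRxMexpNx_1 /weight /= !expr0 !mul1r mulr1 sub0r.
apply: le_trans (pot_le q0 qp pq1 _ _ _) _.
suff : `|theta q beta| <= 1 / 2 by lra.
by rewrite ler_norml th0.
Qed.

Variables (e M G : R).
Hypotheses (e0 : 0 < e) (e1 : e <= 1) (M1 : 1 <= M) (G1 : 1 <= G) (GM : G <= M).

Definition tilt : R := e * (1 - 2 * q) / 16.
(** The eps of the tilt estimates: although [level] is lowered by a multiple of [gain * G], the
    exponent still exceeds [M] by [gain * G]. *)
Definition gain : R := lambda0 q * tilt * e / 4.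

Definition level : R := lambda0 q * (M - gain * G).

Definition too_high (u z : int) (s : seq bool) : bool :=
  [&& (endpoint s == u) || (endpoint s == u + z), level <= (visits u s)%:R &
    (1 + e) * mz p q z * lambda0 q * M <= (visits (u + z) s)%:R].

(** Tested at a passage of [u]: the visits to [u + z] so far are at most their final number, so a
    final shortage already shows there. *)
Definition too_low (u z : int) (s : seq bool) : bool :=
  [&& endpoint s == u, level <= (visits u s)%:R &
    (visits (u + z) s)%:R <= (1 - e) * mz p q z * lambda0 q * M].

Definition too_heavy (u : int) (s : seq bool) : bool :=
  (endpoint s == u) && ((1 + e) * lambda0 q * M <= (visits u s)%:R).

(** The conditions on [z] belong to the event, so that one bound serves all indices: where they fail
    the event is empty. *)
Definition bad (i : nat * int * int) (s : seq bool) : bool :=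
  let: (k, u, z) := i in
  match k with
  | 0 => [&& z != 0, G <= h ^+ `|z|%N * M & too_high u z s]
  | 1 => [&& z != 0, G <= h ^+ `|z|%N * M & too_low u z s]
  | _ => too_heavy u s
  end.

Let q2 : 2 * q < 1. Proof. by move: qp pq1 => *; lra. Qed.

Lemma lambda0_gt0 : 0 < lambda0 q.
Proof.
rewrite /lambda0 mulN1r oppr_gt0 invr_lt0 ln_lt0// q2 andbT mulr_gt0//.
Qed.

Lemma lambda0M : lambda0 q * - ln (2 * q) = 1.
Proof.
rewrite /lambda0 mulN1r mulrNN mulVf// lt_eqF// ln_lt0// q2 andbT mulr_gt0//.
Qed.

Lemma lambda0_tilt : lambda0 q * tilt <= 1 / 16.
Proof.
have c0 : 0 < 2 * q by rewrite mulr_gt0.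
have := lambda0M; have := lambda0_gt0; move: (lambda0 q) => lam l0 lE.
have := ln_le_sub1 c0 => hl.
have lD : lam * (1 - 2 * q) <= 1.
  have : lam * (1 - 2 * q) <= lam * - ln (2 * q) by rewrite ler_wpM2l// ?(ltW l0)//; lra.
  by rewrite lE.
have : lam * (1 - 2 * q) * e <= 1 * 1.
  apply: ler_pM; move: e0 e1 q2 l0 => *; rewrite ?mulr_ge0//; lra.
rewrite /tilt; lra.
Qed.

Lemma tilt_gt0 : 0 < tilt.
Proof. by rewrite /tilt divr_gt0// mulr_gt0// subr_gt0. Qed.

Lemma gain_gt0 : 0 < gain.
Proof. by rewrite /gain divr_gt0// mulr_gt0// mulr_gt0 ?lambda0_gt0 ?tilt_gt0. Qed.

Lemma gain_le : gain <= e / 4.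
Proof.
have := lambda0_tilt; rewrite /gain => hl.
have : lambda0 q * tilt * e <= 1 * e by apply: ler_wpM2r; move: e0 => *; lra.
lra.
Qed.

Let tiltD : 16 * tilt <= 1 - 2 * q.
Proof.
rewrite /tilt; have : e * (1 - 2 * q) <= 1 * (1 - 2 * q).
  by apply: ler_wpM2r => //; move: q2 => *; lra.
lra.
Qed.

(** The three kinds use [beta] equal to [1 + tilt], [1 - tilt] and 1. In the first two,
    [1 <= G <= h ^+ |z| * M] turns the prefactor 4 / h^|z| into at most [4 * M]. *)
Lemma P_bad N i : (P (hits N (bad i)) <=
  ((4 * M + 4 / h) * expR (- (M + gain * G)))%:E)%E.
Proof.
have t0 := tilt_gt0; have tD := tiltD; have l0 := lambda0_gt0.
have h0' := h0; have q0' := q0; have q2' := q2; have e0' := e0; have e1' := e1.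
have G1' := G1; have M1' := M1; have GM' := GM.
have qt : 2 * q * tilt <= tilt by rewrite ler_piMl// ltW.
have qt0 : 0 <= 2 * q * tilt by apply: mulr_ge0; [apply: mulr_ge0|]; lra.
have eE0 := expR_ge0 (- (M + gain * G)).
have b0 : 0 <= (4 * M + 4 / h) * expR (- (M + gain * G)).
  apply: mulr_ge0 => //; apply: addr_ge0; first by lra.
  by apply: divr_ge0 => //; exact: ltW.
have small z : z != 0 -> G <= h ^+ `|z|%N * M ->
    4 / h ^+ `|z|%N * expR (- (M + gain * G)) <= (4 * M + 4 / h) * expR (- (M + gain * G)).
  move=> z0 GH; rewrite ler_wpM2r//.
  have : 4 / h ^+ `|z|%N <= 4 * M.
    by rewrite ler_pdivrMr ?exprn_gt0// mulrAC -mulrA; lra.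
  have : 0 <= 4 / h by rewrite divr_ge0// ltW.
  lra.
have alE (beta : R) z : z != 0 -> alpha p q beta z =
    (1 + theta q beta * (2 * q * mz p q z)) / (2 * q + theta q beta * (2 * q * mz p q z)).
  move=> z0; rewrite /alpha /mz (negPf z0) -/h [2 * q * (_ / _)]mulrC divfK//.
  by rewrite gt_eqF// mulr_gt0.
have mzP z : z != 0 -> G <= h ^+ `|z|%N * M -> [/\ 0 <= mz p q z, mz p q z <= 1 & G <= mz p q z * M].
  move=> z0 GH; rewrite /mz (negPf z0) -/h.
  have a0 : 0 < h ^+ `|z|%N by rewrite exprn_gt0.
  split; first by rewrite divr_ge0// ?mulr_ge0// ltW.
    by rewrite ler_pdivrMr ?mulr_gt0// mul1r (hpow_le q0 qp pq1).
  apply: le_trans GH _; apply: ler_wpM2r; first by lra.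
  by rewrite ler_pdivlMr ?mulr_gt0// ler_piMr ?ltW.
have al0 beta z : z != 0 -> -1 < theta q beta -> 0 < ln (alpha p q beta z).
  by move=> z0 th1; rewrite ln_gt0// al_gt1.
case: i => [[[|[|k]] u] z].
- have [/andP[z0 GH]|nz] := boolP ((z != 0) && (G <= h ^+ `|z|%N * M)); last first.
    by rewrite hits_false// => s; rewrite /bad andbA (negPf nz).
  have [m0 m1 GmM] := mzP _ z0 GH.
  have thE : theta q (1 + tilt) = tilt / (1 - 2 * q * (1 + tilt)).
    by rewrite /theta addrAC subrr add0r.
  have th0 : 0 <= theta q (1 + tilt) by rewrite thE divr_ge0; lra.
  have th1 : theta q (1 + tilt) <= 1 / 2 by rewrite thE ler_pdivrMr; lra.
  apply: le_trans (@P_hits_tilted (1 + tilt) u z N _ (M + gain * G) z0 _ _ _ _) _.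
  + lra.
  + lra.
  + by rewrite ger0_norm.
  + move=> s /and3P[_ _ /and3P[us ks vs]]; split.
      by case/orP: us => /eqP; [left|right].
    apply: le_trans (tilt_upper q0 q2 e0 e1 lambda0M l0 _ GM m0 m1 GmM erefl erefl erefl) _.
      lra.
    rewrite -thE -alE//; apply: lerD; apply: ler_wpM2l => //.
      by apply/ltW/al0 => //; lra.
    by apply: ln_ge0; rewrite lerDl ltW.
  + by rewrite lee_fin small.
- have [/andP[z0 GH]|nz] := boolP ((z != 0) && (G <= h ^+ `|z|%N * M)); last first.
    by rewrite hits_false// => s; rewrite /bad andbA (negPf nz).
  have [m0 m1 GmM] := mzP _ z0 GH.
  have thE : theta q (1 - tilt) = - tilt / (1 - 2 * q * (1 - tilt)).
    by rewrite /theta addrAC subrr add0r.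
  have th0 : theta q (1 - tilt) <= 0 by rewrite thE mulNr oppr_le0 divr_ge0; lra.
  have th1 : - (1 / 2) <= theta q (1 - tilt).
    by rewrite thE mulNr lerN2 ler_pdivrMr; lra.
  apply: le_trans (@P_hits_tilted (1 - tilt) u z N _ (M + gain * G) z0 _ _ _ _) _.
  + lra.
  + lra.
  + by rewrite ler_norml th1 (le_trans th0)//; lra.
  + move=> s /and3P[_ _ /and3P[/eqP us ks vs]]; split; first by left.
    apply: le_trans (tilt_lower q0 q2 e0 e1 lambda0M l0 _ GM m0 m1 GmM erefl erefl erefl) _.
      lra.
    rewrite -thE -alE//; apply: lerD; first apply: ler_wpM2l => //.
      by apply/ltW/al0 => //; lra.
    by apply: ler_wnM2l => //; apply: ln_le0; rewrite gerBl ltW.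
  + by rewrite lee_fin small.
- have th0 : theta q 1 = 0 by rewrite /theta subrr mul0r.
  (* With [beta = 1] only visits to [u] are rewarded, at the rate 1 / (2q). The second site is taken
     at distance 1, which produces the term [4 / h]. *)
  apply: le_trans (@P_hits_tilted 1 u 1 N _ (M + gain * G) isT _ _ _ _) _.
  + lra.
  + lra.
  + by rewrite th0 normr0; lra.
  + move=> s /andP[/eqP us vs]; split; first by left.
    rewrite ln1 mul0r addr0 /alpha th0 !mul0r !addr0 div1r lnV ?posrE ?mulr_gt0//.
    have L0 : 0 <= - ln (2 * q) by rewrite oppr_ge0 ln_le0// ltW.
    apply: le_trans (ler_wpM2l L0 vs).
    rewrite (_ : - ln (2 * q) * ((1 + e) * lambda0 q * M) = lambda0 q * - ln (2 * q) * ((1 + e) * M)); last by ring.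
    rewrite lambda0M mul1r mulrDl mul1r lerD2l.
    apply: ler_pM => //; [exact/ltW/gain_gt0|lra|].
    by apply: le_trans gain_le _; lra.
  + rewrite lee_fin ler_wpM2r// [h ^+ _]expr1 lerDr; lra.
Qed.

End Deviation.

(** * Elementary estimates and the Borel-Cantelli lemma *)

Lemma ln2_ge_half (R : realType) : 1 / 2 <= ln 2 :> R.
Proof. have := @ln_ge_1sub R 2 (ltr0Sn R 1); lra. Qed.

Lemma ln2_le1 (R : realType) : ln 2 <= 1 :> R.
Proof. by have := @ln_le_sub1 R 2 (ltr0Sn R 1); lra. Qed.

Lemma near_le_ln (R : realType) (A : R) : \forall n \near \oo, A <= ln n%:R.
Proof.
exists (Num.truncn (expR A)).+1 => // n /= hn.
have eA : expR A <= n%:R.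
  by apply: le_trans (ltW (truncnS_gt _)) _; rewrite ler_nat.
by rewrite -[leLHS]expRK ler_ln ?posrE ?expR_gt0// (lt_le_trans (expR_gt0 A)).
Qed.

(** The power 4 leaves a summable square after the two factors of order [x] in the union bound. One
    term of the exponential series, of order [m] with [g * m >= 4], suffices. *)
Lemma expR_stretched (R : realType) (k g : R) : 0 < k -> 0 < g ->
  exists2 K : R, 0 < K & forall x, 1 <= x -> expR (- (k * x `^ g)) <= K / x ^+ 4.
Proof.
move=> k0 g0.
pose m := (Num.truncn (4 / g)).+1.
have gm : 4 <= g * m%:R by rewrite mulrC -ler_pdivrMr// ltW// truncnS_gt.
exists (m`!%:R / k ^+ m); first by rewrite divr_gt0 ?exprn_gt0// ltr0n fact_gt0.
move=> x x1; have x0 : 0 < x by exact: lt_le_trans x1.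
have xg : 0 < x `^ g by exact: powR_gt0.
have x4 : x ^+ 4 <= (x `^ g) ^+ m.
  by rewrite -!powR_mulrn ?powR_ge0 ?(ltW x0)// -powRrM; apply: ler_powR.
rewrite expRN ler_pdivlMr ?exprn_gt0// ler_pdivrMl ?expR_gt0//.
have H : 1 + (k * x `^ g) ^+ m / m`!%:R <= expR (k * x `^ g).
  by apply: expR_ge1Dxn; exact: mulr_ge0 (ltW k0) (ltW xg).
have f0 : 0 < (m`!%:R : R) by rewrite ltr0n fact_gt0.
have {}H : (k * x `^ g) ^+ m / m`!%:R <= expR (k * x `^ g) by lra.
rewrite mulrA ler_pdivlMr ?exprn_gt0//.
rewrite ler_pdivrMr// exprMn in H.
by apply: le_trans H; rewrite mulrC ler_wpM2l// exprn_ge0// ltW.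
Qed.

Lemma borel_cantelli_sq {d : measure_display} {T : measurableType d} {R : realType}
    (P : probability T R) (F : nat -> set T) (K : R) : 0 <= K ->
  (forall j, measurable (F j)) ->
  (forall j, (P (F j) <= (K / j.+2%:R ^+ 2)%:E)%E) -> P (lim_sup_set F) = 0%E.
Proof.
move=> K0 mF PF; apply: lim_sup_set_cvg0 => //.
apply: le_lt_trans (ltry K).
apply: lime_le; first by apply: is_cvg_nneseries => n _ _.
apply: nearW => n.
(* Telescoping: 1 / (j + 2)^2 is at most 1 / (j + 1) - 1 / (j + 2). *)
suff : (\sum_(0 <= j < n) P (F j) <= (K * (1 - n.+1%:R^-1))%:E)%E.
  move=> /le_trans; apply; rewrite lee_fin ler_piMr// lerBlDr lerDl invr_ge0//.
elim: n => [|n IH]; first by rewrite big_nil invr1 subrr mulr0.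
rewrite big_nat_recr//=; apply: (le_trans (leeD IH (PF n))).
rewrite -EFinD lee_fin -mulrDr ler_wpM2l//.
have a0 : 0 < (n.+1%:R : R) by [].
rewrite -[n.+2%:R]natr1; move: (n.+1%:R) a0 => x x0.
have -> : 1 - (x + 1)^-1 = 1 - x^-1 + 1 / (x * (x + 1)) by field; lra.
rewrite lerD2l div1r lef_pV2 ?posrE ?exprn_gt0 ?mulr_gt0//; last 2 first.
- by lra.
- by lra.
by rewrite expr2 ler_wpM2r//; lra.
Qed.

(** * Finite ranges of sites for the union bound *)

Definition ints (n : nat) : seq int := [seq Posz i - Posz n | i <- iota 0 (2 * n).+1].

Lemma size_ints n : size (ints n) = (2 * n).+1.
Proof. by rewrite size_map size_iota. Qed.

Lemma mem_ints n (z : int) : (`|z| <= n)%N -> z \in ints n.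
Proof.
move=> zn; apply/mapP; exists (absz (z + Posz n)); last by lia.
by rewrite mem_iota; lia.
Qed.

Definition indices (n m : nat) : seq (nat * int * int) :=
  [seq (ku, z) | ku <- [seq (k, u) | k <- iota 0 3, u <- ints n], z <- ints m].

Lemma size_indices n m : size (indices n m) = (3 * (2 * n).+1 * (2 * m).+1)%N.
Proof. by rewrite !size_allpairs size_iota !size_ints. Qed.

Lemma mem_indices n m (k : nat) (u z : int) :
  (k < 3)%N -> (`|u| <= n)%N -> (`|z| <= m)%N -> (k, u, z) \in indices n m.
Proof.
move=> k3 /mem_ints un /mem_ints zm; apply: allpairs_f => //.
by apply: allpairs_f => //; rewrite mem_iota.
Qed.

(** * Dyadic scales: almost surely only finitely many bad events *)

Section Scales.
Context {d : measure_display} {T : measurableType d} {R : realType}.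
Variables (P : probability T R) (X : nat -> T -> R) (p q c : R).
Hypotheses (q0 : 0 < q) (qp : q < p) (pq1 : p + q = 1).
Hypothesis indX : mutually_independent P X.
Hypothesis PX1 : forall k, P (X k @^-1` [set 1]) = p%:E.
Hypotheses (c0 : 0 < c) (ac1 : ln (1 / hratio p q) * c < 1).

Let h := hratio p q.
Let a := ln (1 / h) * c.

Let p0 : 0 < p. Proof. exact: lt_trans qp. Qed.
Let h0 : 0 < h. Proof. by rewrite /h /hratio divr_gt0. Qed.
Let h1 : h < 1. Proof. by rewrite /h /hratio ltr_pdivrMr// mul1r. Qed.

Lemma exponent_gt0 : 0 < a.
Proof. by rewrite /a mulr_gt0// ln_gt0// ltr_pdivlMr// mul1r. Qed.

(** The logarithm of [horizon j]. The shift by 2 makes it at least 1 and puts the horizon above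
    every n < 2^(j+1). *)
Definition logscale (j : nat) : R := j.+2%:R * ln 2.
Definition horizon (j : nat) : nat := (2 ^ j.+2)%N.
(** A crude bound for c ln ln n from ln x < x; a factor linear in [j] is harmless in the union
    bound. *)
Definition zrange (j : nat) : nat := ((Num.truncn c).+1 * j.+2)%N.
(** The value of h^k x at k = c ln x, hence the smallest h^|z| x over the range of [z]. *)
Definition slack (x : R) : R := x `^ (1 - a).

Lemma logscale_ge1 j : 1 <= logscale j.
Proof.
have := ln2_ge_half R; have : 2 <= j.+2%:R :> R by rewrite ler_nat.
by rewrite /logscale; nra.
Qed.

Lemma logscale_le j : logscale j <= j.+2%:R.
Proof. by rewrite /logscale ler_piMr// ln2_le1. Qed.

Lemma expR_logscale j : expR (logscale j) = (horizon j)%:R.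
Proof. by rewrite /logscale expRM_natl lnK ?posrE// natrX. Qed.

Lemma slack_ge1 x : 1 <= x -> 1 <= slack x.
Proof. by move=> x1; rewrite -(powRr0 x); apply: ler_powR => //; rewrite subr_ge0 ltW. Qed.

Lemma slack_le x : 1 <= x -> slack x <= x.
Proof. by move=> x1; apply: ler1_powR => //; rewrite gerBl ltW// exponent_gt0. Qed.

Definition bad_event (e : R) (j : nat) : set T :=
  \bigcup_(i in [set` indices (horizon j) (zrange j)])
    hits X (horizon j) (bad p q e (logscale j) (slack (logscale j)) i).

Lemma P_bad_event_indices e j : 0 < e -> e <= 1 ->
  let M := logscale j in
  measurable (bad_event e j) /\
  (P (bad_event e j) <= ((size (indices (horizon j) (zrange j)))%:R *
    ((4 * M + 4 / h) * expR (- (M + gain q e * slack M))))%:E)%E.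
Proof.
move=> e0 e1 M; have M1 := logscale_ge1 j.
apply: (P_hits_bigcup indX) => i _.
exact: (P_bad q0 qp pq1 indX PX1 e0 e1 M1 (slack_ge1 M1) (slack_le M1)).
Qed.

(** The number of sites [u] is cancelled by exp(-M) = 1 / [horizon j]. The range of [z] and the
    prefactor cost one factor [j.+2] each, against the fourth power gained from [slack]. *)
Lemma P_bad_event e : 0 < e -> e <= 1 -> exists2 K : R, 0 <= K &
  forall j, (P (bad_event e j) <= (K / j.+2%:R ^+ 2)%:E)%E.
Proof.
move=> e0 e1.
have g0 : 0 < gain q e by exact: (gain_gt0 q0 qp pq1 e0).
have a1 : 0 < 1 - a by rewrite subr_gt0.
have [K K0 HK] := expR_stretched g0 a1.
pose C : R := (2 * (Num.truncn c).+1 + 1)%:R; have C0 : 0 <= C by exact: ler0n.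
have h4 : 0 <= 4 / h by rewrite divr_ge0// ltW.
exists (9 * C * (4 + 4 / h) * (16 * K)).
  by apply: mulr_ge0; [apply: mulr_ge0; [apply: mulr_ge0|]|]; lra.
move=> j; apply: le_trans (P_bad_event_indices j e0 e1).2 _; rewrite lee_fin.
have M1 := logscale_ge1 j; have Mj := logscale_le j; have EM := expR_logscale j.
have Mj2 : j.+2%:R <= 2 * logscale j.
  have : 0 <= (j.+2%:R : R) by []; have := ln2_ge_half R.
  by rewrite /logscale; nra.
move: (logscale j) M1 Mj EM Mj2 => M M1 Mj EM Mj2.
have M0 : 0 < M by lra.
set J : R := j.+2%:R; have J1 : 1 <= J by rewrite /J ler1n.
have J0 : 0 < J by lra.
rewrite size_indices opprD expRD.
have N0 : 0 < (horizon j)%:R :> R by rewrite -EM expR_gt0.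
have N1 : 1 <= (horizon j)%:R :> R by rewrite ler1n expn_gt0.
have s1 : (3 * (2 * horizon j).+1)%:R <= 9 * (horizon j)%:R :> R.
  by rewrite natrM -[(2 * _).+1%:R]natr1 natrM; lra.
have s2 : ((2 * zrange j).+1)%:R <= C * J.
  by rewrite /C /J -natrM ler_nat /zrange mulnDl mul1n -mulnA -addn1 leq_add2l.
have s3 : 4 * M + 4 / h <= (4 + 4 / h) * J.
  have : 4 / h * 1 <= 4 / h * J by rewrite ler_wpM2l// divr_ge0// ltW.
  rewrite mulrDl -/J in Mj *; lra.
(* The factor 16 is 2^4, from [J <= 2 * M]. *)
have s4 : expR (- (gain q e * slack M)) <= 16 * K / J ^+ 4.
  apply: le_trans (HK M M1) _.
  rewrite ler_pdivrMr ?exprn_gt0// mulrAC ler_pdivlMr ?exprn_gt0//.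
  have : J ^+ 4 <= (2 * M) ^+ 4 by apply: lerXn2r => //; rewrite nnegrE; lra.
  by rewrite exprMn => hJ; have := ler_wpM2l (ltW K0) hJ; lra.
have s5 : expR (- M) = (horizon j)%:R^-1 by rewrite expRN EM.
rewrite natrM s5.
apply: (@le_trans _ _ ((9 * (horizon j)%:R * (C * J)) *
  ((4 + 4 / h) * J * ((horizon j)%:R^-1 * (16 * K / J ^+ 4))))).
  apply: ler_pM; first by rewrite mulr_ge0 ?ler0n.
  - by rewrite !mulr_ge0 ?expR_ge0 ?invr_ge0 ?(ltW N0)//; lra.
  - by apply: ler_pM.
  - apply: ler_pM; [lra| |exact: s3|].
      by apply: mulr_ge0; rewrite ?expR_ge0 ?invr_ge0 ?(ltW N0).
    by apply: ler_wpM2l; rewrite ?invr_ge0 ?(ltW N0).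
rewrite le_eqVlt; apply/orP; left; apply/eqP; field.
by rewrite !gt_eqF//; lra.
Qed.

Lemma bad_event_ae e : 0 < e -> e <= 1 ->
  {ae P, forall w, ~ lim_sup_set (bad_event e) w}.
Proof.
move=> e0 e1; have [K K0 HK] := P_bad_event e0 e1.
have mF j : measurable (bad_event e j) by exact: (P_bad_event_indices j e0 e1).1.
have mL : measurable (lim_sup_set (bad_event e)).
  apply: bigcap_measurable => [|i _]; first by exists 0%N.
  by apply: bigcup_measurable => k _.
apply/negligibleP; last first.
  rewrite (_ : ~` _ = lim_sup_set (bad_event e)); first exact: borel_cantelli_sq K0 mF HK.
  by apply/seteqP; split => w /= => [/contrapT|? ?].
by rewrite (_ : ~` _ = lim_sup_set (bad_event e)) //; apply/seteqP; split => w /= => [/contrapT|? ?].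
Qed.

Lemma steps_ae : (forall k, P (X k @^-1` [set -1]) = q%:E) ->
  {ae P, forall w, forall k, X k w = 1 \/ X k w = -1}.
Proof.
move=> PXN1; apply: ae_foralln => k.
have mS (y : R) : measurable (X k @^-1` [set y]).
  by rewrite -[Y in measurable Y]setTI; apply: (indX.1 k) => //; exact: measurable_set1.
have mU := measurableU _ _ (mS 1) (mS (-1)).
suff : P.-negligible (~` (X k @^-1` [set 1] `|` X k @^-1` [set -1])) by [].
apply/negligibleP; first exact: measurableC.
have PU : P (X k @^-1` [set 1] `|` X k @^-1` [set -1]) = 1%E.
  rewrite measureU//; last first.
    apply/seteqP; split => w //= -[-> /eqP].
    by rewrite -subr_eq0 opprK (_ : 1 + 1 = 2%:R)// pnatr_eq0.
  transitivity (p%:E + q%:E)%E; last by rewrite -EFinD pq1.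
  by congr (_ + _)%E; [exact: PX1|exact: PXN1].
rewrite [LHS]probability_setC//; transitivity (1 - 1 : \bar R)%E; last exact: subee.
by congr (_ - _)%E; exact: PU.
Qed.

End Scales.

(** * Comparison of an arbitrary time with its dyadic horizon *)

(** For 2^j <= n < 2^(j+1) the horizon 2^(j+2) lies between n and 4n. *)
Lemma logscale_trunc (R : realType) (n : nat) : (0 < n)%N ->
  let M : R := logscale (trunc_log 2 n) in
  [/\ (n <= horizon (trunc_log 2 n))%N, ln n%:R <= M & M <= ln n%:R + 2 * ln 2].
Proof.
move=> n0 M; have /andP[ln1 ln2] := trunc_log_bounds (isT : (1 < 2)%N) n0.
have nN : (n <= horizon (trunc_log 2 n))%N.
  by apply: leq_trans (ltnW ln2) _; rewrite leq_exp2l.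
have nR : 0 < n%:R :> R by rewrite ltr0n.
split => //.
  by rewrite -[M]expRK expR_logscale ler_ln ?posrE ?ltr0n ?expn_gt0// ler_nat.
rewrite -[M]expRK expR_logscale mulr_natl -lnXn// -lnM ?posrE ?exprn_gt0//.
rewrite ler_ln ?posrE ?mulr_gt0 ?exprn_gt0 ?ltr0n ?expn_gt0//.
rewrite -natrX -natrM ler_nat /horizon 2!expnS mulnA mulnC.
exact: (leq_mul ln1 (leqnn 4)).
Qed.

(** * Pathwise bound on the ratio outside the bad event *)

Section LocalTimeRatio.
Context {d : measure_display} {T : measurableType d} {R : realType}.
Variables (X : nat -> T -> R) (p q c : R).
Hypotheses (q0 : 0 < q) (qp : q < p) (pq1 : p + q = 1).
Hypotheses (c0 : 0 < c) (ac1 : ln (1 / hratio p q) * c < 1).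

Let h := hratio p q.
Let a := ln (1 / h) * c.

Let p0 : 0 < p. Proof. exact: lt_trans qp. Qed.
Let h0 : 0 < h. Proof. by rewrite /h /hratio divr_gt0. Qed.

Lemma mz_gt0 z : 0 < mz p q z.
Proof. by rewrite /mz; case: ifP => // _; apply: divr_gt0; [exact: exprn_gt0|exact: mulr_gt0]. Qed.

(** Since k ln(1/h) <= a ln x <= a ln y, h^k is at least y^(-a). This supplies the condition on [z]
    in [bad]. *)
Lemma hpow_ge_slack (x y : R) (k : nat) : 1 <= x -> x <= y -> k%:R <= c * ln x ->
  slack p q c y <= h ^+ k * y.
Proof.
move=> x1 xy kx.
have x0 : 0 < x by lra.
have y0 : 0 < y by lra.
have L0 : 0 < ln (1 / h).
  by rewrite ln_gt0// ltr_pdivlMr// mul1r /h /hratio ltr_pdivrMr// mul1r.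
rewrite /slack powRB; last by rewrite gt_eqF// implybT.
rewrite powRr1 ?(ltW y0)// mulrC ler_wpM2r ?(ltW y0)// -powRN.
rewrite /powR gt_eqF// -[h ^+ k]lnK ?posrE ?exprn_gt0// ler_expR.
rewrite lnXn// -mulr_natl -/h -/a.
have -> : ln h = - ln (1 / h) by rewrite div1r lnV ?posrE// opprK.
rewrite mulNr mulrN lerN2.
apply: le_trans (ler_wpM2r (ltW L0) kx) _.
rewrite mulrAC [c * _]mulrC ler_wpM2l ?mulr_ge0 ?(ltW L0) ?(ltW c0)//.
by rewrite ler_ln.
Qed.

Variables (w : T) (E dn : R) (n j : nat).
Hypothesis Xw : forall k, X k w = 1 \/ X k w = -1.
Hypotheses (E0 : 0 < E) (E1 : E <= 1).

Let M : R := logscale j.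
Let e := E / 2.
Let G := slack p q c M.
Let lam := lambda0 q.

Hypothesis not_bad : ~ bad_event X p q c e j w.
Hypotheses (nN : (n <= horizon j)%N) (l1 : 1 <= ln n%:R :> R) (lM : ln n%:R <= M).
Hypothesis eM : (1 + e) * M <= (1 + E) * ln n%:R.
Hypothesis gM : M - gain q e * G <= (1 - dn) * ln n%:R.
Hypothesis dnE : dn <= E.

(** Each violation at time [n] would already show at a passage time [i <= n], where the path
    satisfies one of the predicates in [bad]: [too_heavy] for [z = 0], [too_low] or [too_high]
    otherwise. *)
Lemma local_time_ratio u z :
  (1 - dn) * lam * ln n%:R <= (xi X u n w)%:R ->
  `|z|%N%:R <= c * ln (ln n%:R) ->
  `| (xi X (u + z) n w)%:R / (mz p q z * lam * ln n%:R) - 1 | <= E.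
Proof.
rewrite !xi_visits//.
set L : R := ln n%:R; have L1 : 1 <= L := l1; have LM : L <= M := lM.
have lam0 : 0 < lam by exact: (lambda0_gt0 q0 qp pq1).
have gM' : M - gain q e * G <= (1 - dn) * L := gM.
have eM' : (1 + e) * M <= (1 + E) * L := eM.
have m0 := mz_gt0 z; have E0' := E0; have E1' := E1.
have e0 : 0 < e by rewrite /e; lra.
have e1 : e <= 1 by rewrite /e; lra.
have M1 : 1 <= M by exact: logscale_ge1.
have G1 : 1 <= G by apply: slack_ge1.
have GM : G <= M by apply: slack_le.
have gn0 : 0 < gain q e by exact: (gain_gt0 q0 qp pq1 e0).
have gn : gain q e <= e / 4 by exact: (gain_le q0 qp pq1 e0 e1).
have lev0 : 0 < level q e M G.
  rewrite /level mulr_gt0// subr_gt0; apply: (@le_lt_trans _ _ (1 / 4 * M)); last by lra.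
  by apply: ler_pM; lra.
have notbad k v y i : (k < 3)%N -> (`|v| <= horizon j)%N -> (`|y| <= zrange c j)%N ->
    (i <= n)%N -> ~~ bad p q e M G (k, v, y) (steps X i w).
  move=> k3 vN yZ ni; apply/negP => Hb; apply: not_bad.
  exists (k, v, y); first exact: mem_indices.
  by exists i; split => //; exact: leq_trans nN.
move=> Hu Hz.
have Hlev : level q e M G <= (visits u (steps X n w))%:R.
  apply: le_trans Hu; have := ler_wpM2l (ltW lam0) gM'.
  by rewrite /level -/lam; lra.
have uN : (`|u| <= horizon j)%N.
  rewrite leqNgt; apply/negP => uN; move: Hlev; rewrite visits_far ?leNgt ?lev0//.
  by rewrite size_steps; exact: leq_ltn_trans uN.
have zZ : (`|z| <= zrange c j)%N.
  rewrite -(ler_nat R); apply: le_trans Hz _; rewrite /zrange natrM.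
  apply: ler_pM; [exact: ltW|exact: ln_ge0|exact/ltW/truncnS_gt|].
  apply: le_trans (ltW (ln_sublinear _)) _; first by lra.
  exact: le_trans LM (logscale_le j).
have L0 : 0 < L by exact: lt_le_trans ltr01 L1.
have M0 : 0 < M by exact: lt_le_trans ltr01 M1.
have D0 : 0 < mz p q z * lam * L by apply: mulr_gt0 => //; exact: mulr_gt0.
have e2 : 0 < 1 + e by exact: addr_gt0.
rewrite ler_norml lerBrDr lerBlDr ler_pdivlMr// ler_pdivrMr//.
have [z0|z0] := eqVneq z 0.
  (* For [z = 0] the lower bound is the assumption on [u] itself, as [dn <= E]. *)
  move: D0; rewrite z0 addr0 {1 2 3}/mz eqxx mul1r => D0; apply/andP; split.
    apply: le_trans Hu; rewrite -mulrA; apply: ler_wpM2r; first exact: ltW.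
    by have := dnE; lra.
  rewrite leNgt; apply/negP => H.
  have K0 : 0 < (1 + e) * lam * M by apply: mulr_gt0 => //; exact: mulr_gt0.
  have HK : (1 + e) * lam * M <= (visits u (steps X n w))%:R.
    by apply: le_trans (ltW H); have := ler_wpM2l (ltW lam0) eM'; lra.
  have [i [ni ei Hi _]] := first_passage K0 HK.
  have := notbad 2%N u 0 i isT uN isT ni.
  by rewrite /bad /too_heavy ei eqxx /= Hi.
have GH : G <= h ^+ `|z|%N * M by exact: hpow_ge_slack l1 lM Hz.
have ml0 : 0 <= mz p q z * lam by rewrite mulr_ge0// ltW.
apply/andP; split; rewrite leNgt; apply/negP => H.
  have [i [ni ei Hi _]] := first_passage lev0 Hlev.
  have := notbad 1%N u z i isT uN zZ ni.
  rewrite /bad /too_low z0 GH ei eqxx Hi /= => /negP; apply.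
  apply: (@le_trans _ _ (visits (u + z) (steps X n w))%:R).
    by rewrite ler_nat visits_mono.
  apply: le_trans (ltW H) _.
  (* The shortage at time [n] is measured with [L], the bad event with [M]; here [L <= M] and
     [e <= E]. *)
  have : (- E + 1) * L <= (1 - e) * M by apply: ler_pM; rewrite /e; lra.
  by move=> hh; have := ler_wpM2l ml0 hh; rewrite -/lam; lra.
have K0 : 0 < (1 + e) * mz p q z * lam * M.
  by apply: mulr_gt0 => //; apply: mulr_gt0 => //; exact: mulr_gt0.
have HK : (1 + e) * mz p q z * lam * M <= (visits (u + z) (steps X n w))%:R.
  by apply: le_trans (ltW H); have := ler_wpM2l ml0 eM'; lra.
have [i ni [ei Hi Hi']] := joint_passage lev0 K0 Hlev HK.
have := notbad 0%N u z i isT uN zZ ni.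
rewrite /bad /too_high z0 GH Hi Hi' !andbT /= => /negP; apply.
by case: ei => ->; rewrite eqxx ?orbT.
Qed.

End LocalTimeRatio.

(** * Almost sure conclusion *)

Lemma local_time_ratio_ae (d : measure_display) (T : measurableType d) (R : realType)
  (P : probability T R) (X : nat -> T -> R) (p q c : R) (delta : nat -> R) (E : R) :
  0 < q -> q < p -> p + q = 1 ->
  mutually_independent P X ->
  (forall k, P (X k @^-1` [set 1]) = p%:E) ->
  (forall k, P (X k @^-1` [set -1]) = q%:E) ->
  0 < c -> ln (1 / hratio p q) * c < 1 ->
  (fun n : nat => delta n * (ln n%:R) `^ (ln (1 / hratio p q) * c)) @ \oo --> 0 ->
  0 < E -> E <= 1 ->
  {ae P, forall w : T,
      \forall n \near \oo,
        forall u : int,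
          ((1 - delta n) * lambda0 q * ln n%:R <= (xi X u n w)%:R) ->
          forall z : int, (`|z|%N%:R <= c * ln (ln n%:R)) ->
            `| (xi X (u + z) n w)%:R / (mz p q z * lambda0 q * ln n%:R) - 1 | <= E}.
Proof.
move=> q0 qp pq1 indX PX1 PXN1 c0 ac1 dlim E0 E1.
set a := ln (1 / hratio p q) * c in ac1 dlim *.
pose e := E / 2.
have e0 : 0 < e by rewrite /e; lra.
have e1 : e <= 1 by rewrite /e; lra.
have gn0 : 0 < gain q e by exact: (gain_gt0 q0 qp pq1 e0).
have gn : gain q e <= e / 4 by exact: (gain_le q0 qp pq1 e0 e1).
have a0 : 0 < a by exact: (exponent_gt0 q0 qp c0).
have l20 : 0 < ln 2 :> R by have := ln2_ge_half R; lra.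
apply: filterS2 (steps_ae pq1 indX PX1 PXN1)
  (bad_event_ae q0 qp pq1 indX PX1 c0 ac1 e0 e1) => w Xw nlim.
have [j0 Hj0] : exists j0, forall j, (j0 <= j)%N -> ~ bad_event X p q c e j w.
  apply: contrapT => H; apply: nlim => i _; apply: contrapT => Hi; apply: H.
  by exists i => j ij Hb; apply: Hi; exists j.
have dsmall : \forall n \near \oo, `|delta n * (ln n%:R) `^ a| < gain q e / 2.
  by move/cvgr0Pnorm_lt : dlim; apply; rewrite divr_gt0.
near=> n => u Hu z Hz.
have n0 : (0 < n)%N by near: n; exists 1%N.
have [nN lM Ml] := logscale_trunc R n0.
set j := trunc_log 2 n in nN lM Ml.
have l1 : 1 <= ln n%:R :> R by near: n; exact: near_le_ln.
have nb : ~ bad_event X p q c e j w.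
  by apply: Hj0; apply: trunc_log_max => //; near: n; exists (2 ^ j0)%N.
(* As [E = 2 * e], the spare [e * ln n] absorbs the shift of at most [2 * ln 2] between ln n and
   [logscale j]. *)
have big1 : (1 + e) * (2 * ln 2) / e <= ln n%:R :> R by near: n; exact: near_le_ln.
have big2 : (4 * ln 2 / gain q e) `^ ((1 - a)^-1) <= ln n%:R :> R.
  by near: n; exact: near_le_ln.
have dn : `|delta n * (ln n%:R) `^ a| < gain q e / 2 by near: n; exact: dsmall.
move: dn; rewrite ltr_norml => /andP[_ dn].
have b0 : 0 < 1 - a by rewrite subr_gt0.
have L0 : 0 < ln n%:R :> R by lra.
have La1 := ler_powR l1 (ltW a0); rewrite powRr0 in La1.
have dnE : delta n <= E.
  have [d0|d0] := leP (delta n) 0; first by lra.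
  have : delta n * 1 <= delta n * (ln n%:R) `^ a by apply: ler_wpM2l => //; exact: ltW.
  by move: gn; rewrite /e; lra.
apply: (local_time_ratio q0 qp pq1 c0 ac1 Xw E0 E1 nb nN l1 lM _ _ dnE Hu Hz).
  rewrite ler_pdivrMr// in big1.
  have : (1 + e) * logscale j <= (1 + e) * (ln n%:R + 2 * ln 2) by apply: ler_wpM2l => //; lra.
  by move: big1; rewrite /e; lra.
rewrite -/e.
(* Half of the gain pays for the shift by [2 * ln 2], the other half for [delta n]. *)
have G4 : 4 * ln 2 <= gain q e * (ln n%:R) `^ (1 - a).
  rewrite -ler_pdivrMl// mulrC.
  have r0 : 0 <= 4 * ln 2 / gain q e by apply: divr_ge0; [lra|exact: ltW].
  have -> : 4 * ln 2 / gain q e = (4 * ln 2 / gain q e) `^ (1 - a)^-1 `^ (1 - a).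
    by rewrite -powRrM mulVf ?powRr1// gt_eqF.
  by apply: ge0_ler_powR; rewrite ?nnegrE ?powR_ge0 ?(ltW b0) ?(ltW L0).
have Gl : (ln n%:R) `^ (1 - a) <= slack p q c (logscale j).
  by apply: ge0_ler_powR; rewrite ?nnegrE ?(ltW b0) ?(ltW L0)//; lra.
(* The decay rate of [delta] enters here: ln n is split into its powers [a] and [1 - a]. *)
have dl : delta n * ln n%:R <= gain q e / 2 * (ln n%:R) `^ (1 - a).
  have -> : delta n * ln n%:R = delta n * (ln n%:R) `^ a * (ln n%:R) `^ (1 - a).
    rewrite -mulrA -powRD ?subrKC ?powRr1// ?(ltW L0)//.
    by rewrite gt_eqF// implybT.
  by apply: ler_wpM2r; [exact: powR_ge0|exact: ltW].
have Gg := ler_wpM2l (ltW gn0) Gl.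
lra.
Unshelve. all: by end_near.
Qed.

Theorem theorem3p5 (d : measure_display) (T : measurableType d) (R : realType)
  (P : probability T R) (X : nat -> T -> R) (p q c : R) (delta : nat -> R) :
  0 < q -> q < p -> p < 1 -> p + q = 1 ->
  mutually_independent P X ->
  (forall k, P (X k @^-1` [set 1]) = p%:E) ->
  (forall k, P (X k @^-1` [set -1]) = q%:E) ->
  0 < c -> ln (1 / hratio p q) * c < 1 ->
  (fun n : nat => delta n * (ln n%:R) `^ (ln (1 / hratio p q) * c)) @ \oo --> 0 ->
  {ae P, forall w : T,
    forall e : R, 0 < e ->
      \forall n \near \oo,
        forall u : int,
          ((1 - delta n) * lambda0 q * ln n%:R <= (xi X u n w)%:R) ->
          forall z : int, (`|z|%N%:R <= c * ln (ln n%:R)) ->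
            `| (xi X (u + z) n w)%:R / (mz p q z * lambda0 q * ln n%:R) - 1 | <= e}.
Proof.
move=> q0 qp _ pq1 indX PX1 PXN1 c0 ac1 dlim.
(* The tolerances 1 / (i + 1) suffice, so only countably many null sets are discarded. *)
have Hi (i : nat) : (0 < i.+1%:R^-1 :> R) /\ (i.+1%:R^-1 <= 1 :> R).
  by rewrite invr_gt0 ltr0n invf_le1 ?ltr0n// ler1n.
have H i := local_time_ratio_ae q0 qp pq1 indX PX1 PXN1 c0 ac1 dlim (Hi i).1 (Hi i).2.
apply: filterS (ae_foralln H) => w Hw e e0.
have ie : (Num.truncn e^-1).+1%:R^-1 <= e.
  by rewrite invf_ple ?posrE// ltW// truncnS_gt.
apply: filterS (Hw (Num.truncn e^-1)) => n Hn u Hu z Hz.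
exact: le_trans (Hn u Hu z Hz) ie.
Qed.
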